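(* Let $f$ be a vector field on a manifold $M$. For integral curves $(q,p)$ of the adjoint system $\frac{d}{dt}(q,p)=\widehat f(q,p)$ on $T^*M$ and $(q,\delta q)$ of the variational equation $\frac{d}{dt}(q,\delta q)=\widetilde f(q,\delta q)$ on $TM$ which cover the same curve $q$ in $M$, $$\frac{d}{dt}\Big\langle (q(t),p(t)),(q(t),\delta q(t))\Big\rangle_{q(t)}=0,$$ where $\langle\cdot,\cdot\rangle_q$ is the duality pairing of $T_q^*M$ with $T_qM$.
   Context: All manifolds and maps are smooth. Let $\Phi_\epsilon$ be the (local) flow of $f$. The cotangent lift is $\widehat f(z)=\frac{d}{d\epsilon}\big|_{\epsilon=0}(\Phi_{-\epsilon})^*(z)$, a vector field on $T^*M$ (with $(\Phi_{-\epsilon})^*$ the cotangent lifted flow covering $\Phi_\epsilon$); in coordinates the adjoint system is $\dot q^A=f^A(q)$, $\dot p_A=-p_B\,\partial f^B(q)/\partial q^A$. The tangent lift is $\widetilde f(q,\delta q)=\frac{d}{d\epsilon}\big|_{\epsilon=0}T\Phi_\epsilon(q,\delta q)$, a vector field on $TM$; in coordinates the variational equation is $\dot q^A=f^A(q)$, $\frac{d}{dt}\delta q^A=\frac{\partial f^A(q)}{\partial q^B}\delta q^B$. *)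

(* Defs.v *)
From HB Require Import structures.
From mathcomp Require Import all_boot all_order all_algebra.
From mathcomp Require Import all_classical all_reals all_analysis.

Set Implicit Arguments.
Unset Strict Implicit.
Unset Printing Implicit Defensive.

Import Order.TTheory GRing.Theory Num.Theory.
Import numFieldNormedType.Exports.

Local Open Scope classical_set_scope.
Local Open Scope ring_scope.

(* An element of P when there is one, and x0 otherwise; unlike xget, T need   *)
(* not be a choiceType.                                                       *)
Definition the (T : Type) (x0 : T) (P : T -> Prop) : T :=
  if pselect (exists x, P x) is left e then projT1 (cid e) else x0.

Section Smooth.
Context (R : realType) (V W : normedModType R).

(* f is of class C^k on the open set U. In finite dimension it is enough to   *)
(* iterate over the directional derivatives of f.                             *)
Fixpoint class_C (k : nat) (U : set V) (f : V -> W) : Prop :=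
  if k is k'.+1 then
    (forall x, U x -> differentiable f x) /\
    (forall v, class_C k' U (fun x => 'd f x v))
  else forall x, U x -> {for x, continuous f}.

Definition smooth_on (U : set V) (f : V -> W) : Prop :=
  forall k, class_C k U f.

End Smooth.

(* A family of charts of X with values in E: the chart of index i is          *)
(* [crd i : dom i -> E], and [prm i] is its inverse; the values of [crd i]    *)
(* outside of [dom i] and of [prm i] outside of the image of [crd i] are      *)
(* irrelevant. The axioms are stated in [is_smooth_atlas].                    *)
Record atlas (X E : Type) := Atlas {
  idx : Type;
  dom : idx -> set X;
  crd : idx -> X -> E;
  prm : idx -> E -> X }.

Record is_smooth_atlas (R : realType) (E : normedModType R)
    (M : topologicalType) (A : atlas M E) : Prop := IsSmoothAtlas {
  atlas_cover : forall q : M, exists i : idx A, dom i q;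
  atlas_open_dom : forall i : idx A, open (dom i);
  atlas_open_img : forall i : idx A, open (crd i @` dom i);
  atlas_invK : forall (i : idx A) q, dom i q -> prm i (crd i q) = q;
  atlas_crd_continuous : forall (i : idx A) q, dom i q -> {for q, continuous (crd i)};
  atlas_inv_continuous : forall (i : idx A) q, dom i q ->
    {for crd i q, continuous (prm i)};
  atlas_smooth_transition : forall i j : idx A,
    smooth_on (crd i @` (dom i `&` dom j)) (crd j \o prm i) }.

Record manifold (R : realType) (n : nat) := Manifold {
  mspace :> topologicalType;
  matlas : atlas mspace 'rV[R]_n;
  manifold_smooth : is_smooth_atlas matlas;
  manifold_hausdorff : hausdorff_space mspace;
  manifold_second_countable : @second_countable mspace }.

(* A tangent vector at q is the family v of its components in the charts at   *)
(* q, related to each other by the differentials of the changes of charts.    *)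
(* The components in the other charts are set to 0, so that the tangent space *)
(* is isomorphic to E through any chart at q.                                 *)
Section TangentSpace.
Context (R : realType) (E : normedModType R) (X : Type) (A : atlas X E).

Definition tangent_family (q : X) : {pred idx A -> E} := fun v =>
  `[< (forall i : idx A, ~ dom i q -> v i = 0) /\
      (forall i j : idx A, dom i q -> dom j q ->
         v j = 'd (crd j \o prm i) (crd i q) (v i)) >].

Fact tangent_family_submod (q : X) : submod_closed (tangent_family q).
Proof.
split=> [|a u v /asboolP[u0 uE] /asboolP[v0 vE]]; apply/asboolP; split.
- by [].
- by move=> i j _ _; rewrite linear0.
- by move=> i iq; rewrite -[LHS]/(a *: u i + v i) u0 // v0 // scaler0 addr0.
- move=> i j iq jq; rewrite -[LHS]/(a *: u j + v j).
  by rewrite -[in RHS]/(a *: u i + v i) linearP -uE // -vE.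
Qed.

HB.instance Definition _ (q : X) :=
  GRing.isSubmodClosed.Build R (idx A -> E) (tangent_family q)
    (tangent_family_submod q).

Record tangent (q : X) := Tangent {
  tcomp :> idx A -> E;
  _ : tcomp \in tangent_family q }.

HB.instance Definition _ (q : X) := [isSub for @tcomp q].
HB.instance Definition _ (q : X) := [Choice of tangent q by <:].
HB.instance Definition _ (q : X) :=
  [SubChoice_isSubLmodule of tangent q by <:].

Definition cotangent (q : X) := {linear tangent q -> R^o}.

Definition pairing (q : X) (p : cotangent q) (v : tangent q) : R := p v.

(* The tangent vector at q with components u in the chart i; for a smooth     *)
(* atlas there is exactly one when [dom i q].                                 *)
Definition tangent_of (i : idx A) (q : X) (u : E) : tangent q :=
  xget 0 [set v : tangent q | v i = u].

End TangentSpace.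

Section Curves.
Context (R : realType) (E : normedModType R) (X : Type) (A : atlas X E).

(* The curve c is at x at time t, and has there the velocity w. Requiring     *)
(* that c stays in the chart domains at x for times near t is what remains of *)
(* the continuity of c at t, given that its coordinates are differentiable.   *)
(* No topology on X is needed, which allows X to be TM or T^*M.               *)
Definition has_velocity (c : R -> X) (t : R) (x : X) (w : tangent A x) : Prop :=
  c t = x /\
  forall i : idx A, dom i x ->
    (\forall s \near t, dom i (c s)) /\ is_derive t 1 (crd i \o c) (w i).

Definition velocity (c : R -> X) (t : R) (x : X) : tangent A x :=
  xget 0 [set w | has_velocity c t w].

Definition vector_field := forall x : X, tangent A x.

Definition integral_curve (f : vector_field) (J : set R) (c : R -> X) : Prop :=
  forall t, J t -> has_velocity c t (f (c t)).

Definition smooth_field (f : vector_field) : Prop :=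
  forall i : idx A, smooth_on (crd i @` dom i) (fun u => f (prm i u) i).

(* The differential of g at q is the linear map given in charts by the        *)
(* differential of the expression of g.                                       *)
Definition differential (g : X -> X) (q : X) :
    {linear tangent A q -> tangent A (g q)} :=
  the [the {linear tangent A q -> tangent A (g q)} of \0] (fun L =>
    forall v (i j : idx A), dom i q -> dom j (g q) ->
      L v j = 'd (crd j \o g \o prm i) (crd i q) (v i)).

Definition TM : Type := {q : X & tangent A q}.
Definition TsM : Type := {q : X & cotangent A q}.

(* (q, v) |-> (q^A, v^A) *)
Definition tangent_atlas : atlas TM (E * E)%type :=
  {| idx := idx A;
     dom := fun i => [set z : TM | dom i (projT1 z)];
     crd := fun i (z : TM) => (crd i (projT1 z), projT2 z i);
     prm := fun i y => existT _ (prm i y.1) (tangent_of i (prm i y.1) y.2)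
  |}.

Definition tangent_map (g : X -> X) (z : TM) : TM :=
  existT _ (g (projT1 z)) (differential g (projT1 z) (projT2 z)).

(* g^* : T^*_{g x} M -> T^*_x M *)
Definition pullback (g : X -> X) (x : X) (p : cotangent A (g x)) :
  cotangent A x := p \o differential g x.

End Curves.

Section CotangentAtlas.
Context (R : realType) (n : nat) (X : Type) (A : atlas X 'rV[R]_n).

(* The covector at q with components a in the chart i.                        *)
Definition covector_of (i : idx A) (q : X) (a : 'rV[R]_n) (v : tangent A q) :
  R^o :=
  \sum_k a 0 k * v i 0 k.

Fact covector_of_linear i q a : linear (@covector_of i q a).
Proof.
move=> b u v; rewrite /covector_of scaler_sumr -big_split /=.
by apply: eq_bigr => k _; rewrite !mxE mulrDr mulrCA.
Qed.

HB.instance Definition _ i q a :=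
  GRing.isLinear.Build R (tangent A q) R^o *:%R (@covector_of i q a)
    (@covector_of_linear i q a).

(* (q, p) |-> (q^A, p_A), where p_A is the value of p on the A-th coordinate  *)
(* vector.                                                                    *)
Definition cotangent_atlas : atlas (TsM A) ('rV[R]_n * 'rV[R]_n)%type :=
  {| idx := idx A;
     dom := fun i => [set z : TsM A | dom i (projT1 z)];
     crd := fun i (z : TsM A) =>
       (crd i (projT1 z),
        \row_k (projT2 z (tangent_of i (projT1 z) (delta_mx 0 k))));
     prm := fun i y => existT (cotangent A) (prm i y.1)
       (@covector_of i (prm i y.1) y.2 : {linear _ -> _})
  |}.

End CotangentAtlas.

Section Lifts.
Context (R : realType) (n : nat) (M : manifold R n).
Let A := matlas M.

(* Phi is a smooth local flow with infinitesimal generator f, defined on the  *)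
(* flow domain D, an open neighborhood of {0} x M.                            *)
Record local_flow (f : vector_field A) (D : set (R * M)) (Phi : R -> M -> M) :
    Prop := LocalFlow {
  flow_open : open D;
  flow_interval : forall q, is_interval [set t | D (t, q)];
  flow_domain0 : forall q, D (0, q);
  flow_continuous : forall z, D z ->
    {for z, continuous (fun y : R * M => Phi y.1 y.2)};
  flow_smooth : forall i j : idx A,
    smooth_on
      [set y : R * 'rV[R]_n | (crd i @` dom i) y.2 /\
        D (y.1, prm i y.2) /\ dom j (Phi y.1 (prm i y.2))]
      (fun y => crd j (Phi y.1 (prm i y.2)));
  flow0 : forall q, Phi 0 q = q;
  flowD : forall s t q, D (s, q) -> D (t, Phi s q) -> D (t + s, q) ->
    Phi (t + s) q = Phi t (Phi s q);
  flow_generator : forall q,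
    integral_curve f [set t | D (t, q)] (fun t => Phi t q) }.

(* The cotangent lift of Phi_eps, covering Phi_eps: it sends (q, p) to        *)
(* (Phi_eps(q), (Phi_{-eps})^* p). The pullback (Phi_{-eps})^* is defined on  *)
(* the fiber at Phi_{-eps}(Phi_eps(q)), which is the fiber at q for small     *)
(* eps; the default value 0 is irrelevant.                                    *)
Definition cotangent_flow (Phi : R -> M -> M) (eps : R) (z : TsM A) : TsM A :=
  let: existT q p := z in
  existT (cotangent A) (Phi eps q)
    (if pselect (q = Phi (- eps) (Phi eps q)) is left e
     then pullback (ecast x (cotangent A x) e p)
     else [the cotangent A _ of \0]).

(* f-hat and f-tilde *)
Definition cotangent_lift (Phi : R -> M -> M) :
    vector_field (cotangent_atlas A) :=
  fun z =>
    velocity (cotangent_atlas A) (fun eps => cotangent_flow Phi eps z) 0 z.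

Definition tangent_lift (Phi : R -> M -> M) : vector_field (tangent_atlas A) :=
  fun z => velocity (tangent_atlas A) (fun eps => tangent_map (Phi eps) z) 0 z.

End Lifts.

(* Main.v *)
Require Import Defs.
From HB Require Import structures.
From mathcomp Require Import all_boot all_order all_algebra.
From mathcomp Require Import all_classical all_reals all_analysis.

Set Implicit Arguments.
Unset Strict Implicit.
Unset Printing Implicit Defensive.

Import Order.TTheory GRing.Theory Num.Theory.
Import numFieldNormedType.Exports.

Local Open Scope classical_set_scope.
Local Open Scope ring_scope.

(* The lifted flows preserve the duality pairing: the pairing of              *)
(* (Phi_{-eps})^* p with T Phi_eps v is p(T(Phi_{-eps} o Phi_eps) v) = p(v)    *)
(* for small eps. In a chart the pairing is the sum of p_k v^k, so            *)
(* differentiating this constant at eps = 0 shows that the momentum component *)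
(* a' of f-hat(q, p) and the velocity component w' of f-tilde(q, v) satisfy   *)
(*   sum_k (p_k w'^k + v^k a'_k) = 0.                                         *)
(* By the product rule, the left-hand side is also the time derivative of the *)
(* pairing along integral curves of f-hat and f-tilde over the same curve.    *)
(* Neither the equality of mixed partial derivatives nor the coordinate       *)
(* formulas of the lifts are needed, but the two lifts must be shown to be    *)
(* genuine velocities (not the default value 0): this uses that the flow and  *)
(* the transition maps are of class C^2.                                      *)

(** The invariance of the pairing is [near_pairing_flow]. It rests on the chain rule
    [differential_comp] and on [near_flowK], by which Phi_{-eps} o Phi_eps is the identity near q.
    [lifts_pairing] differentiates it at eps = 0 with the product rule [is_derive_sum_mul], once
    [cotangent_flow_velocity] and [tangent_flow_velocity] have identified the derivatives of the
    lifted flows with the lifts. The same product rule along the integral curves produces exactly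
    the sum that [lifts_pairing] shows to vanish. *)

Section Calculus.
Context (R : realType).
Implicit Types V W : normedModType R.

(** The first-order expansion of f at x is also one of g, since value and remainder only involve
    points near x. Chart expressions agree only locally, so most of the differentiability proofs
    below pass through this. *)
Lemma near_eq_differentiable V W (f g : V -> W) x :
  {near x, f =1 g} -> differentiable f x -> differentiable g x.
Proof.
move=> fg df; have [dfc /eqaddoP fE] := (diff_locallyP _ _).1 df.
have gE : g \o shift x = cst (g x) + 'd f x +o_ 0 id.
  have fg0 : \forall y \near (0 : V), f (y + x) = g (y + x).
    by move: fg; rewrite (near_shift 0); apply: filterS => y /=; rewrite subr0.
  apply/eqaddoP => e e0; have fEe := fE e e0; near=> y.
  have -> : (g \o shift x - (cst (g x) + 'd f x)) y =
            (f \o shift x - (cst (f x) + 'd f x)) y.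
    by rewrite !fctE /= (nbhs_singleton fg) (near fg0 y).
  by near: y.
apply/diff_locallyP; rewrite (diff_unique dfc gE).
by split.
Unshelve. all: by end_near. Qed.

Lemma near_eq_diff V W (f g : V -> W) x :
  {near x, f =1 g} -> differentiable f x -> 'd g x = 'd f x :> (V -> W).
Proof.
move=> fg df; have dg := near_eq_differentiable fg df.
by apply/funext => v; rewrite -!deriveE// -(near_eq_derive _ fg).
Qed.

Lemma differentiable_row V n (f : V -> 'rV[R]_n) x :
  (forall k, differentiable (fun y => f y 0 k : R) x) -> differentiable f x.
Proof.
move=> df.
have -> : f = \sum_(k < n) (fun y => f y 0 k *: (delta_mx 0 k : 'rV[R]_n)).
  by apply/funext => y; rewrite fct_sumE [LHS]row_sum_delta.
by apply: differentiable_sum => k; exact: differentiableZl.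
Qed.

Lemma differentiable_entry V n (f : V -> 'rV[R]_n) x k :
  differentiable f x -> differentiable (fun y => f y 0 k : R) x.
Proof.
move=> df; apply: (@differentiable_comp _ _ _ _ f (fun N : 'rV[R]_n => N 0 k : R)) => //.
exact: differentiable_coord.
Qed.

Lemma differentiable_fst V W (x : V * W) : differentiable (@fst V W) x.
Proof. apply/linear_differentiable => y; exact: cvg_fst. Qed.

Lemma differentiable_snd V W (x : V * W) : differentiable (@snd V W) x.
Proof. apply/linear_differentiable => y; exact: cvg_snd. Qed.

Lemma differentiable_sum_mul V n (f g : 'I_n -> V -> R) x :
  (forall k, differentiable (f k) x) -> (forall k, differentiable (g k) x) ->
  differentiable (fun y => \sum_k f k y * g k y) x.
Proof.
move=> df dg.
have -> : (fun y => \sum_k f k y * g k y) = \sum_k (f k * g k).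
  by apply/funext => y; rewrite fct_sumE.
by apply: differentiable_sum => k; exact: differentiableM.
Qed.

(** [smooth_on] controls the differential in a fixed direction only; this expansion reduces a
    direction that varies with the point to fixed ones. *)
Lemma diff_rowE V n (f : 'rV[R]_n -> V) x u :
  'd f x u = \sum_k u 0 k *: 'd f x (delta_mx 0 k).
Proof. by rewrite {1}(row_sum_delta u) linear_sum; apply: eq_bigr => k _; rewrite linearZ. Qed.

Lemma smooth_on_differentiable V W U (f : V -> W) x :
  smooth_on U f -> U x -> differentiable f x.
Proof. by move=> /(_ 1%N)[+ _] => /[apply]. Qed.

Lemma smooth_on_diff V W U (f : V -> W) v :
  smooth_on U f -> smooth_on U (fun x => 'd f x v).
Proof. by move=> fs k; have [_] := fs k.+1; apply. Qed.

End Calculus.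

(** * Tangent vectors and differentials in charts *)

Section Charts.
Context (R : realType) (E : normedModType R) (M : topologicalType).
Context (A : atlas M E) (As : is_smooth_atlas A).
Implicit Types (i j k : idx A) (q : M) (g h : M -> M).

Lemma near_prm i q (P : set M) : dom i q -> nbhs q P ->
  \forall x \near crd i q, P (prm i x).
Proof.
move=> iq qP; apply: (atlas_inv_continuous As iq).
by rewrite /= (atlas_invK As iq).
Qed.

Lemma near_dom i q : dom i q -> \forall r \near q, dom i r.
Proof. by move=> iq; exact: open_nbhs_nbhs (conj (atlas_open_dom As i) iq). Qed.

Lemma near_crd i q (P : set E) : dom i q -> nbhs (crd i q) P ->
  \forall r \near q, P (crd i r).
Proof. by move=> iq; exact: (atlas_crd_continuous As iq). Qed.

Lemma near_crdK i q : dom i q -> \forall x \near crd i q, crd i (prm i x) = x.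
Proof.
move=> iq; have : nbhs (crd i q) (crd i @` dom i).
  by apply: open_nbhs_nbhs; split; [exact: atlas_open_img As i|exists q].
by apply: filterS => _ [r ir <-]; rewrite (atlas_invK As ir).
Qed.

(** Continuity of g is not implied, since [crd j] is arbitrary outside [dom j]; it is a separate
    hypothesis in the lemmas on composites. *)
Definition chart_differentiable g q := forall i j, dom i q -> dom j (g q) ->
  differentiable (crd j \o g \o prm i) (crd i q).

(** Continuity keeps g r in [dom j] for r near q, and there [prm j] cancels [crd j]. *)
Lemma near_chart_comp g h q i j k : dom i q -> dom j (g q) ->
    {for q, continuous g} ->
  {near crd i q, (crd k \o h \o prm j) \o (crd j \o g \o prm i) =1
                 crd k \o (h \o g) \o prm i}.
Proof.
move=> iq jq gc; have /(near_prm iq) : \forall r \near q, dom j (g r).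
  exact: gc (near_dom jq).
by apply: filterS => x jx; rewrite /= (atlas_invK As jx).
Qed.

Section Composition.
Variables (g h : M -> M) (q : M).
Hypotheses (gc : {for q, continuous g}) (dg : chart_differentiable g q).
Hypothesis dh : chart_differentiable h (g q).

Let diff_chart_near i j k : dom i q -> dom j (g q) -> dom k (h (g q)) ->
  differentiable ((crd k \o h \o prm j) \o (crd j \o g \o prm i)) (crd i q).
Proof.
move=> iq jq kq; apply: differentiable_comp; first exact: dg.
by rewrite /= (atlas_invK As iq); exact: dh.
Qed.

Lemma chart_differentiable_comp : chart_differentiable (h \o g) q.
Proof.
move=> i k iq kq; have [j jq] := atlas_cover As (g q).
apply: near_eq_differentiable (diff_chart_near iq jq kq).
exact: near_chart_comp.
Qed.

Lemma diff_chart_comp i j k u : dom i q -> dom j (g q) -> dom k (h (g q)) ->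
  'd (crd k \o (h \o g) \o prm i) (crd i q) u =
  'd (crd k \o h \o prm j) (crd j (g q)) ('d (crd j \o g \o prm i) (crd i q) u).
Proof.
move=> iq jq kq; rewrite (near_eq_diff _ (diff_chart_near iq jq kq)).
  rewrite diff_comp /= ?(atlas_invK As iq)//; first exact: dg.
  exact: dh.
exact: near_chart_comp.
Qed.

End Composition.

(** The chart expressions of [id] are the transition maps, so a change of chart becomes a case of
    the chain rule. *)
Lemma chart_differentiable_id q : chart_differentiable id q.
Proof.
move=> i j iq jq.
by apply: smooth_on_differentiable (atlas_smooth_transition As i j) _; exists q.
Qed.

Lemma diff_chart_id i q u : dom i q -> 'd (crd i \o prm i) (crd i q) u = u.
Proof.
move=> iq; have idE : {near crd i q, id =1 crd i \o prm i}.
  by apply: filterS (near_crdK iq) => x /= ->.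
by rewrite (near_eq_diff idE) ?diff_val.
Qed.

Lemma tangent0 q (v : tangent A q) i : ~ dom i q -> v i = 0.
Proof. by have /asboolP[v0 _] := valP v; exact: v0. Qed.

Lemma tangentE q (v : tangent A q) i j : dom i q -> dom j q ->
  v j = 'd (crd j \o prm i) (crd i q) (v i).
Proof. by have /asboolP[_ vE] := valP v; exact: vE. Qed.

Lemma tangent_ext q (v w : tangent A q) :
  (forall i, dom i q -> v i = w i) -> v = w.
Proof.
move=> vw; apply: val_inj; apply/funext => i /=.
by have [/vw//|iq] := pselect (dom i q); rewrite !tangent0.
Qed.

Lemma tangent_inj i q (v w : tangent A q) : dom i q -> v i = w i -> v = w.
Proof.
move=> iq vw; apply: tangent_ext => j jq.
by rewrite (tangentE v iq jq) vw -(tangentE w iq jq).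
Qed.

(** [tangent_of] is a choice, so a vector with these components must be exhibited: u is pushed to
    the other charts at q by the transition differentials. *)
Lemma tangent_ofE i q u : dom i q -> tangent_of i q u i = u.
Proof.
move=> iq; apply: (@xgetPex _ 0 [set v : tangent A q | v i = u]).
pose v j := if pselect (dom j q) is left _
            then 'd (crd j \o prm i) (crd i q) u else 0.
have vP : v \in @tangent_family _ _ _ A q.
  apply/asboolP; split => [j jq|j k jq kq]; rewrite /v.
    by case: pselect.
  case: pselect => // _; case: pselect => // _.
  (* Compatibility of the components is the cocycle rule, that is, the chain rule for [id \o id]. *)
  by apply: (@diff_chart_comp id id) => //; exact: chart_differentiable_id.
exists (Tangent vP) => /=; rewrite /v; case: pselect => // _.
exact: diff_chart_id.
Qed.

Lemma theP (T : Type) (x0 : T) (P : T -> Prop) : (exists x, P x) -> P (the x0 P).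
Proof. by rewrite /the => exP; case: pselect => // e; exact: projT2 (cid e). Qed.

Lemma differentialE g q (v : tangent A q) i j :
    {for q, continuous g} -> chart_differentiable g q ->
    dom i q -> dom j (g q) ->
  differential A g q v j = 'd (crd j \o g \o prm i) (crd i q) (v i).
Proof.
move=> gc dg.
(* [differential] falls back on 0 unless a linear map satisfies the formula in all charts; one is
   built from a single pair of charts. *)
suff: exists L : {linear tangent A q -> tangent A (g q)},
    forall v (i j : idx A), dom i q -> dom j (g q) ->
      L v j = 'd (crd j \o g \o prm i) (crd i q) (v i).
  by move=> /(theP [the {linear tangent A q -> tangent A (g q)} of \0]); exact.
have [i0 i0q] := atlas_cover As q; have [j0 j0q] := atlas_cover As (g q).
pose L (w : tangent A q) : tangent A (g q) :=
  tangent_of j0 (g q) ('d (crd j0 \o g \o prm i0) (crd i0 q) (w i0)).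
have L_lin : linear L.
  move=> a u w; apply: (tangent_inj j0q); rewrite tangent_ofE//.
  rewrite -[RHS]/(a *: L u j0 + L w j0) !tangent_ofE//.
  by rewrite -[X in 'd _ _ X]/(a *: u i0 + w i0) linearP.
pose LM := GRing.isLinear.Build _ _ _ _ L L_lin.
pose LL : {linear tangent A q -> tangent A (g q)} := HB.pack L LM.
exists LL => w k l kq lq; rewrite -[LL w]/(L w).
rewrite (tangentE (L w) j0q lq) tangent_ofE// (tangentE w kq i0q).
(* Composing with [id] on either side of g changes the chart at q and at g q. *)
rewrite -(@diff_chart_comp id g q) //; last exact: chart_differentiable_id.
rewrite -(@diff_chart_comp g id q) //.
exact: chart_differentiable_id.
Qed.

Lemma differential_comp g h q (v : tangent A q) :
    {for q, continuous g} -> chart_differentiable g q ->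
    {for g q, continuous h} -> chart_differentiable h (g q) ->
  differential A h (g q) (differential A g q v) = differential A (h \o g) q v.
Proof.
move=> gc dg hc dh.
have [i iq] := atlas_cover As q; have [j jq] := atlas_cover As (g q).
have [k kq] := atlas_cover As (h (g q)).
apply: (tangent_inj kq); rewrite (differentialE _ hc dh jq kq).
rewrite (differentialE _ gc dg iq jq).
rewrite (differentialE _ _ _ iq kq); first by rewrite -diff_chart_comp.
  exact: continuous_comp.
exact: chart_differentiable_comp.
Qed.

(* The two sides are tangent vectors at [g q] and at [q], which are only       *)
(* propositionally equal; hence the statement in components.                  *)
Lemma differential_near_id g q (v : tangent A q) i : {near q, g =1 id} ->
  differential A g q v i = v i.
Proof.
move=> gid; have gq : g q = q := nbhs_singleton gid.
have gc : {for q, continuous g}.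
  rewrite /prop_for /continuous_at gq.
  apply: cvg_trans (near_eq_cvg _) (@cvg_id _ (nbhs q)).
  by apply: filterS gid => r ->.
have nid (j k : idx A) : dom j q -> {near crd j q, crd k \o prm j =1 crd k \o g \o prm j}.
  by move=> jq; apply: filterS (near_prm jq gid) => x /= ->.
have dg : chart_differentiable g q.
  move=> j k jq; rewrite gq => kq.
  exact: near_eq_differentiable (nid j k jq) (chart_differentiable_id jq kq).
have [iq|iq] := pselect (dom i q); last by rewrite !tangent0// gq.
rewrite (differentialE _ gc dg iq) ?gq//.
rewrite (near_eq_diff (nid i i iq)) ?diff_chart_id//.
exact: (chart_differentiable_id iq iq).
Qed.

End Charts.

(** * Existence of velocities *)

Lemma near_fst (V W : topologicalType) (x : V) (y : W) (P : set V) :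
  (\forall v \near x, P v) -> \forall z \near (x, y), P z.1.
Proof. by move=> xP; exact: cvg_fst xP. Qed.

(** The derivatives of the coordinates form a tangent vector by the chain rule through the
    transitions, so [velocity] is not its default 0. Cancellation of [prm] is required in
    coordinates only: on TM and T^*M an equality of points would be one of dependent pairs. *)
Lemma has_velocity_velocity (R : realType) (E : normedModType R) (X : Type)
    (A : atlas X E) (c : R -> X) t x : c t = x ->
  (forall i : idx A, dom i x ->
     (\forall s \near t, dom i (c s)) /\ derivable (crd i \o c) t 1) ->
  (forall (i j : idx A) y, dom i y -> dom j y -> crd j (prm i (crd i y)) = crd j y) ->
  (forall i j : idx A, dom i x -> dom j x ->
     differentiable (crd j \o prm i) (crd i x)) ->
  has_velocity c t (velocity A c t x).
Proof.
case: x / => cA crdK dA; apply: (@xgetPex _ 0 [set w | has_velocity c t w]).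
pose w (i : idx A) := if pselect (dom i (c t)) is left _
            then 'D_1 (crd i \o c) t else 0.
have wP : w \in @tangent_family _ _ _ A (c t).
  apply/asboolP; split => [i ic|i j ic jc]; rewrite /w.
    by case: pselect.
  case: pselect => // _; case: pselect => // _.
  have [ic_near dci] := cA i ic; have [jc_near dcj] := cA j jc.
  have cE : {near t, crd j \o c =1 (crd j \o prm i) \o (crd i \o c)}.
    near=> s; rewrite /= crdK//; first by near: s.
    by near: s.
  have dci' := (derivable1_diffP _ _).1 dci.
  rewrite (near_eq_derive _ cE) deriveE; last exact: differentiable_comp (dA _ _ _ _).
  by rewrite diff_comp//= ?deriveE//; exact: dA.
exists (Tangent wP); split=> // i ic; have [ic_near dci] := cA i ic; split=> //.
by rewrite /= /w; case: pselect => // _; exact: derivableP.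
Unshelve. all: by end_near. Qed.

(** * Transition maps of the tangent and cotangent bundles *)

Section Coordinates.
Context (R : realType) (n : nat) (M : topologicalType).
Context (A : atlas M 'rV[R]_n) (As : is_smooth_atlas A).
Implicit Types (i j k : idx A) (q : M).

Lemma tangent_sum q (I : Type) (r : seq I) (v : I -> tangent A q) i :
  (\sum_(a <- r) v a) i = \sum_(a <- r) v a i.
Proof. exact: (big_morph (fun w : tangent A q => w i)). Qed.

Lemma tangentZ q a (v : tangent A q) i : (a *: v) i = a *: v i.
Proof. by []. Qed.

Lemma cotangentE q (p : cotangent A q) (v : tangent A q) i : dom i q ->
  p v = \sum_k p (tangent_of i q (delta_mx 0 k)) * v i 0 k.
Proof.
move=> iq.
have vE : v = \sum_k v i 0 k *: tangent_of i q (delta_mx 0 k).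
  apply: (tangent_inj iq); rewrite tangent_sum [LHS]row_sum_delta.
  by apply: eq_bigr => k _; rewrite tangentZ tangent_ofE.
by rewrite {1}vE linear_sum; apply: eq_bigr => k _; rewrite linearZ /= mulrC.
Qed.

Lemma differentiable_transition i j q : dom i q -> dom j q ->
  differentiable (crd j \o prm i) (crd i q).
Proof. exact: chart_differentiable_id. Qed.

Lemma differentiable_diff_transition i j q u : dom i q -> dom j q ->
  differentiable (fun x => 'd (crd j \o prm i) x u) (crd i q).
Proof.
move=> iq jq; have Ts := smooth_on_diff u (atlas_smooth_transition As i j).
by apply: smooth_on_differentiable Ts _; exists q.
Qed.

(** This makes the chosen fibre part of the bundle charts explicit, on one neighbourhood for all u,
    because the fibre coordinate varies too. *)
Lemma near_tangent_ofE i j q : dom i q -> dom j q ->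
  \forall x \near crd i q, forall u,
    tangent_of i (prm i x) u j = 'd (crd j \o prm i) x u.
Proof.
move=> iq jq; near=> x => u.
have ix : dom i (prm i x) by near: x; exact: (near_prm As iq (near_dom As iq)).
have jx : dom j (prm i x) by near: x; exact: (near_prm As iq (near_dom As jq)).
have xE : crd i (prm i x) = x by near: x; exact: (near_crdK As iq).
rewrite (tangentE (tangent_of i (prm i x) u) ix jx).
rewrite xE.
by rewrite (tangent_ofE As u ix).
Unshelve. all: by end_near. Qed.

Lemma tangent_crdK (i j : idx (tangent_atlas A)) z : dom i z -> dom j z ->
  crd j (prm i (crd i z)) = crd j z.
Proof.
case: z => q v /= iq jq; rewrite (atlas_invK As iq); congr pair.
by rewrite (tangentE _ iq jq) (tangent_ofE As)// (tangentE v iq jq).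
Qed.

(** The transition is (x, u) |-> (T x, dT_x u), which is differentiable because T is of class
    C^2. *)
Lemma differentiable_tangent_transition i j q (v : tangent A q) : dom i q -> dom j q ->
  differentiable (@crd _ _ (tangent_atlas A) j \o @prm _ _ (tangent_atlas A) i)
    (crd i q, v i).
Proof.
move=> iq jq; set T := crd j \o prm i.
have dfst := @differentiable_fst R 'rV_n 'rV_n (crd i q, v i).
have TE : {near (crd i q, v i),
    (fun y : 'rV[R]_n * 'rV[R]_n => (T y.1, 'd T (y.1) y.2)) =1
    @crd _ _ (tangent_atlas A) j \o @prm _ _ (tangent_atlas A) i}.
  apply: filterS (near_fst (v i) (near_tangent_ofE iq jq)) => y E /=.
  by rewrite E.
apply: near_eq_differentiable TE _; apply: differentiable_pair.
  exact: (differentiable_comp dfst (differentiable_transition iq jq)).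
apply: differentiable_row => l.
have -> : (fun y : 'rV[R]_n * 'rV[R]_n => 'd T (y.1) y.2 0 l : R) =
    fun y => \sum_k y.2 0 k * 'd T (y.1) (delta_mx 0 k) 0 l.
  apply/funext => y; rewrite diff_rowE summxE.
  by apply: eq_bigr => k _; rewrite !mxE.
apply: differentiable_sum_mul => k; apply: differentiable_entry.
  exact: differentiable_snd.
exact: (differentiable_comp dfst (differentiable_diff_transition _ iq jq)).
Qed.

Lemma cotangent_crdK (i j : idx (cotangent_atlas A)) z : dom i z -> dom j z ->
  crd j (prm i (crd i z)) = crd j z.
Proof.
case: z => q p /= iq jq; congr pair; first by rewrite (atlas_invK As iq).
apply/rowP => k; rewrite !mxE /= /covector_of (cotangentE p _ iq).
by apply: eq_bigr => l _; rewrite mxE (atlas_invK As iq).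
Qed.

(** Covectors change by the transpose of the differential of the inverse transition T', taken at T
    x: the k-th new component is the value on the k-th coordinate vector of chart j, read in chart
    i. *)
Lemma differentiable_cotangent_transition i j q a : dom i q -> dom j q ->
  differentiable (@crd _ _ (cotangent_atlas A) j \o @prm _ _ (cotangent_atlas A) i)
    (crd i q, a).
Proof.
move=> iq jq; set T := crd j \o prm i; set T' := crd i \o prm j.
have dfst := @differentiable_fst R 'rV_n 'rV_n (crd i q, a).
pose F := fun y : 'rV[R]_n * 'rV[R]_n => (T y.1,
  \row_k \sum_l y.2 0 l * 'd T' (T y.1) (delta_mx 0 k) 0 l).
have TE : {near (crd i q, a), F =1
    @crd _ _ (cotangent_atlas A) j \o @prm _ _ (cotangent_atlas A) i}.
  have jn := near_fst a (near_prm As iq (near_dom As jq)).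
  have En := near_fst a (near_prm As iq (near_crd As jq (near_tangent_ofE jq iq))).
  apply: filterS2 jn En => y jy E; rewrite /F /=; congr pair.
  apply/rowP => k; rewrite !mxE; apply: eq_bigr => l _; congr (_ * _).
  by rewrite -E (atlas_invK As jy).
apply: near_eq_differentiable TE _; apply: differentiable_pair.
  exact: (differentiable_comp dfst (differentiable_transition iq jq)).
apply: differentiable_row => k.
have -> : (fun y : 'rV[R]_n * 'rV[R]_n =>
    (\row_k \sum_l y.2 0 l * 'd T' (T y.1) (delta_mx 0 k) 0 l) 0 k : R) =
    fun y => \sum_l y.2 0 l * 'd T' (T y.1) (delta_mx 0 k) 0 l.
  by apply/funext => y; rewrite mxE.
apply: differentiable_sum_mul => l; apply: differentiable_entry.
  exact: differentiable_snd.
apply: (@differentiable_comp _ _ _ _ (T \o fst)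
  (fun x => 'd T' x (delta_mx 0 _))).
  exact: (differentiable_comp dfst (differentiable_transition iq jq)).
rewrite /T /= (atlas_invK As iq); exact: differentiable_diff_transition.
Qed.

End Coordinates.

(** * The product rule for the pairing in coordinates *)

Lemma is_derive_linear (R : realType) (V W : normedModType R)
    (l : {linear V -> W}) (c : R -> V) (t : R) w :
  continuous l -> is_derive t 1 c w -> is_derive t 1 (l \o c) (l w).
Proof.
move=> lc [dc <-]; have dc' := (derivable1_diffP _ _).1 dc.
have dl := linear_differentiable (c t) lc.
apply: DeriveDef; first exact/derivable1_diffP/differentiable_comp.
by rewrite deriveE ?deriveE//; [rewrite diff_comp//= diff_lin|exact: differentiable_comp].
Qed.

(** The curves a and b stand for chart expressions in T^*M and TM, whose second components are the
    fibre coordinates. *)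
Lemma is_derive_sum_mul (R : realType) n (a b : R -> 'rV[R]_n * 'rV[R]_n) (t : R) da db :
  is_derive t 1 a da -> is_derive t 1 b db ->
  is_derive t 1 (fun s => \sum_k (a s).2 0 k * (b s).2 0 k)
    (\sum_k ((a t).2 0 k * db.2 0 k + (b t).2 0 k * da.2 0 k)).
Proof.
have entry (c : R -> 'rV[R]_n * 'rV[R]_n) dc k : is_derive t 1 c dc ->
    is_derive t 1 (fun s => (c s).2 0 k : R) (dc.2 0 k).
  move=> cdc; have c2 : is_derive t 1 (snd \o c) dc.2.
    by apply: is_derive_linear => // y; exact: cvg_snd.
  have [c2d c2E] := c2; rewrite -c2E derive_mx// mxE.
  by apply: derivableP; exact: (derivable_mxP _ _ _).1.
move=> ha hb; have -> : (fun s => \sum_k (a s).2 0 k * (b s).2 0 k) =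
    \sum_k ((fun s => (a s).2 0 k : R) * (fun s => (b s).2 0 k : R)).
  by apply/funext => s; rewrite fct_sumE.
by apply: is_derive_sum => k; apply: is_deriveM; exact: entry.
Qed.

(** * The lifted flows, their velocities and the pairing *)

Section Flow.
Context (R : realType) (n : nat) (M : manifold R n).
Context (f : vector_field (matlas M)) (D : set (R * M)) (Phi : R -> M -> M).
Hypothesis Phi_flow : local_flow f D Phi.
Let A := matlas M.
Let As : is_smooth_atlas A := manifold_smooth M.
Implicit Types (i j k : idx A) (q : M) (e : R).

Lemma flow_continuous_space e q : D (e, q) -> {for q, continuous (Phi e)}.
Proof.
move=> Deq; have Fc := flow_continuous Phi_flow Deq.
apply: (continuous_comp (f := fun r => (e, r)) (g := fun y => Phi y.1 y.2)) => //.
exact: cvg_pair (cvg_cst _) (@cvg_id _ (nbhs q)).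
Qed.

Lemma flow_continuous_time e q : D (e, q) -> {for e, continuous (Phi ^~ q)}.
Proof.
move=> Deq; have Fc := flow_continuous Phi_flow Deq.
apply: (continuous_comp (f := fun e => (e, q)) (g := fun y => Phi y.1 y.2)) => //.
exact: cvg_pair (@cvg_id _ (nbhs e)) (cvg_cst _).
Qed.

Lemma near_flow_domain e q : D (e, q) -> \forall y \near (e, q), D y.
Proof. by move=> Deq; apply: open_nbhs_nbhs; split=> //; exact: flow_open Phi_flow. Qed.

(** Both points tend to (0, q), which lies in the open set D. *)
Lemma near_flow_time q : \forall e \near (0 : R), D (e, q) /\ D (- e, Phi e q).
Proof.
have D0 := flow_domain0 Phi_flow q.
have cq : ((e, q) @[e --> (0 : R)]) --> ((0 : R), q).
  exact: cvg_pair (@cvg_id _ (nbhs (0 : R))) (cvg_cst _).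
have cP : ((- e, Phi e q) @[e --> (0 : R)]) --> ((0 : R), q).
  have c1 : (- e @[e --> (0 : R)]) --> (0 : R).
    by rewrite -[X in _ --> X]oppr0; exact: (@oppr_continuous R R^o 0).
  have c2 : (Phi e q @[e --> (0 : R)]) --> q.
    by rewrite -[X in _ --> X](flow0 Phi_flow); exact: flow_continuous_time.
  exact: cvg_pair c1 c2.
have H1 : \forall e \near (0 : R), D (e, q) := cq _ (near_flow_domain D0).
have H2 : \forall e \near (0 : R), D (- e, Phi e q) := cP _ (near_flow_domain D0).
by apply: filterS2 H1 H2 => e.
Qed.

(** The flow law, on a neighbourhood of q and not just at q, so that the composite can be
    differentiated. *)
Lemma near_flowK e q : D (e, q) -> D (- e, Phi e q) ->
  {near q, Phi (- e) \o Phi e =1 id}.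
Proof.
move=> De De'.
have H1 : \forall r \near q, D (e, r).
  have cq : ((e, r) @[r --> q]) --> (e, q).
    exact: cvg_pair (cvg_cst _) (@cvg_id _ (nbhs q)).
  exact: cq _ (near_flow_domain De).
have H2 : \forall r \near q, D (- e, Phi e r).
  have cq : ((- e, Phi e r) @[r --> q]) --> (- e, Phi e q).
    exact: cvg_pair (cvg_cst _) (flow_continuous_space De).
  exact: cq _ (near_flow_domain De').
apply: filterS2 H1 H2 => r Der De'r /=.
rewrite -(flowD Phi_flow Der De'r) ?addNr ?(flow0 Phi_flow)//.
exact: flow_domain0 Phi_flow r.
Qed.

(** Time and position are joint arguments because the lifts differentiate the space differential of
    the flow in time. *)
Definition chart_flow i j (y : R * 'rV[R]_n) := crd j (Phi y.1 (prm i y.2)).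

Lemma differentiable_chart_flow i j e q : D (e, q) -> dom i q -> dom j (Phi e q) ->
  differentiable (chart_flow i j) (e, crd i q).
Proof.
move=> De iq jq; apply: smooth_on_differentiable (flow_smooth Phi_flow i j) _.
by split; [exists q|rewrite /= (atlas_invK As iq)].
Qed.

Lemma differentiable_diff_chart_flow i j e q u :
    D (e, q) -> dom i q -> dom j (Phi e q) ->
  differentiable (fun y => 'd (chart_flow i j) y u) (e, crd i q).
Proof.
move=> De iq jq.
apply: smooth_on_differentiable (smooth_on_diff u (flow_smooth Phi_flow i j)) _.
by split; [exists q|rewrite /= (atlas_invK As iq)].
Qed.

Lemma flow_chart_differentiable e q : D (e, q) -> chart_differentiable A (Phi e) q.
Proof.
move=> De i j iq jq.
apply: (differentiable_comp (f := fun x => (e, x)) (g := chart_flow i j)).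
  exact: differentiable_pair.
exact: differentiable_chart_flow.
Qed.

(** The direction (0, u) does not depend on e, so the right-hand side is differentiable in e by
    [differentiable_diff_chart_flow]. *)
Lemma diff_flow e q i j u : D (e, q) -> dom i q -> dom j (Phi e q) ->
  'd (crd j \o Phi e \o prm i) (crd i q) u =
  'd (chart_flow i j) (e, crd i q) (0, u).
Proof.
move=> De iq jq.
rewrite -[crd j \o Phi e \o prm i]/(chart_flow i j \o (fun x => (e, x))).
rewrite diff_comp /=; last exact: differentiable_chart_flow.
  by rewrite diff_pair//= diff_cst diff_val.
exact: differentiable_pair.
Qed.

Lemma differential_flowE e q (v : tangent A q) i j :
    D (e, q) -> dom i q -> dom j (Phi e q) ->
  differential A (Phi e) q v j = 'd (chart_flow i j) (e, crd i q) (0, v i).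
Proof.
move=> De iq jq; rewrite -diff_flow//; apply: (differentialE As) => //.
  exact: flow_continuous_space.
exact: flow_chart_differentiable.
Qed.

Lemma near_dom_flow i q : dom i q -> \forall e \near (0 : R), dom i (Phi e q).
Proof.
move=> iq; apply: flow_continuous_time; first exact: flow_domain0 Phi_flow q.
by rewrite (flow0 Phi_flow); exact: near_dom.
Qed.

Lemma tangent_flow0 (z : TM A) : tangent_map (Phi 0) z = z.
Proof.
(* Replacing the whole map [Phi 0] makes the two fibres convertible, so that the pairs can be
   compared componentwise. *)
case: z => q v; have -> : Phi 0 = id by apply/funext; exact: flow0 Phi_flow.
congr existT; apply: tangent_ext => i iq.
by apply: (differential_near_id As); exact: nearW.
Qed.

(** The transport in [cotangent_flow] disappears in coordinates. *)
Lemma ecast_cotangentE q q' (E : q = q') (p : cotangent A q) (w : tangent A q') i :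
  dom i q ->
  (ecast x (cotangent A x) E p) w = \sum_k p (tangent_of i q (delta_mx 0 k)) * w i 0 k.
Proof. by case: q' / E w => w iq; exact: cotangentE. Qed.

Lemma cotangent_flowE e q (p : cotangent A q) i (w : tangent A (Phi e q)) :
    dom i q -> q = Phi (- e) (Phi e q) ->
  projT2 (cotangent_flow Phi e (existT (cotangent A) q p)) w =
  \sum_k p (tangent_of i q (delta_mx 0 k)) *
         differential A (Phi (- e)) (Phi e q) w i 0 k.
Proof.
move=> iq E; rewrite /=; case: pselect => // E'.
by rewrite -(ecast_cotangentE E').
Qed.

Lemma linear_ext (V W : lmodType R) (p p' : {linear V -> W}) : p =1 p' -> p = p'.
Proof.
case: p => s [[m] [l]]; case: p' => s' [[m'] [l']] /= /funext ss'.
by subst s'; rewrite (Prop_irrelevance m m') (Prop_irrelevance l l').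
Qed.

Lemma cotangent_flow0 (z : TsM A) : cotangent_flow Phi 0 z = z.
Proof.
have Phi0 : Phi 0 = id by apply/funext; exact: flow0 Phi_flow.
case: z => q p; rewrite /cotangent_flow oppr0 Phi0; case: pselect => // E.
(* Here [E] proves q = q, so the transport along it is trivial. *)
rewrite (Prop_irrelevance E erefl) /=; have -> // : pullback (g := id) p = p.
apply: linear_ext => v; rewrite /=; congr (p _); apply: tangent_ext => i iq.
by apply: (differential_near_id As); exact: nearW.
Qed.

Lemma derivable_tangent_flow q (v : tangent A q) i : dom i q ->
  derivable (@crd _ _ (tangent_atlas A) i \o
             (fun e => tangent_map (Phi e) (existT (tangent A) q v))) (0 : R) 1.
Proof.
move=> iq; have D0 := flow_domain0 Phi_flow q.
have i0 : dom i (Phi 0 q) by rewrite (flow0 Phi_flow).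
have cE : {near (0 : R),
    (fun e => (chart_flow i i (e, crd i q),
               'd (chart_flow i i) (e, crd i q) (0, v i))) =1
    @crd _ _ (tangent_atlas A) i \o (fun e => tangent_map (Phi e) (existT _ q v))}.
  apply: filterS2 (near_flow_time q) (near_dom_flow iq) => e [De _] ie /=.
  by rewrite /chart_flow /= (atlas_invK As iq) (differential_flowE v De iq ie).
apply/derivable1_diffP; apply: near_eq_differentiable cE _.
have de : differentiable (fun e : R => (e, crd i q)) 0 by exact: differentiable_pair.
apply: differentiable_pair.
  exact: (differentiable_comp de (differentiable_chart_flow _ _ _)).
exact: (differentiable_comp de (differentiable_diff_chart_flow _ _ _ _)).
Qed.

Lemma tangent_flow_velocity (z : TM A) :
  has_velocity (fun e => tangent_map (Phi e) z) 0 (tangent_lift Phi z).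
Proof.
case: z => q v; apply: has_velocity_velocity => [|i iq||i j iq jq].
- exact: tangent_flow0.
- by split; [exact: (near_dom_flow iq)|exact: (derivable_tangent_flow iq)].
- exact: (tangent_crdK As).
- exact: (differentiable_tangent_transition As).
Qed.

(** The momentum part pairs p with the image under T Phi_{-e} of the k-th coordinate vector at
    Phi_e(q); hence time -e and the moved base point. *)
Lemma near_cotangent_flow_crd q (p : cotangent A q) i : dom i q ->
  \forall e \near (0 : R),
    @crd _ _ (cotangent_atlas A) i (cotangent_flow Phi e (existT (cotangent A) q p)) =
    (chart_flow i i (e, crd i q),
     \row_k \sum_l p (tangent_of i q (delta_mx 0 l)) *
       'd (chart_flow i i) (- e, chart_flow i i (e, crd i q)) (0, delta_mx 0 k) 0 l).
Proof.
move=> iq; apply: filterS2 (near_flow_time q) (near_dom_flow iq) => e [De De'] ie.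
have qE := nbhs_singleton (near_flowK De De').
rewrite /chart_flow /= (atlas_invK As iq); congr pair.
apply/rowP => k; rewrite !mxE (cotangent_flowE _ _ iq (esym qE)).
have iq' : dom i (Phi (- e) (Phi e q)) by move: iq; rewrite -{1}qE.
apply: eq_bigr => l _.
by rewrite (differential_flowE _ De' ie iq') (tangent_ofE As _ ie).
Qed.

Lemma derivable_cotangent_flow q (p : cotangent A q) i : dom i q ->
  derivable (@crd _ _ (cotangent_atlas A) i \o
             (fun e => cotangent_flow Phi e (existT (cotangent A) q p))) (0 : R) 1.
Proof.
move=> iq; have D0 := flow_domain0 Phi_flow q.
have i0 : dom i (Phi 0 q) by rewrite (flow0 Phi_flow).
apply/derivable1_diffP; apply: near_eq_differentiable.
  by apply: filterS (near_cotangent_flow_crd p iq) => e; exact: esym.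
have de : differentiable (fun e : R => (e, crd i q)) 0 by exact: differentiable_pair.
have dF : differentiable (fun e : R => chart_flow i i (e, crd i q)) 0.
  exact: (differentiable_comp de (differentiable_chart_flow _ _ _)).
apply: differentiable_pair => //; apply: differentiable_row => k.
pose b l e := 'd (chart_flow i i) (- e, chart_flow i i (e, crd i q)) (0, delta_mx 0 k) 0 l.
rewrite (_ : (fun e => _) = fun e : R =>
  \sum_l cst (p (tangent_of i q (delta_mx 0 l)) : R) e * b l e); last first.
  by apply/funext => e; rewrite mxE.
apply: differentiable_sum_mul => l //; apply: differentiable_entry.
apply: (@differentiable_comp _ _ _ _
  (fun e : R => (- e, chart_flow i i (e, crd i q)))
  (fun y => 'd (chart_flow i i) y (0, delta_mx 0 k))).
  exact: differentiable_pair.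
(* At e = 0 the inner map takes the value (0, [crd i q]), where the differential of the flow is
   differentiable. *)
rewrite /= oppr0 /chart_flow /= (atlas_invK As iq) (flow0 Phi_flow).
exact: differentiable_diff_chart_flow.
Qed.

Lemma cotangent_flow_velocity (z : TsM A) :
  has_velocity (fun e => cotangent_flow Phi e z) 0 (cotangent_lift Phi z).
Proof.
case: z => q p; apply: has_velocity_velocity => [|i iq||i j iq jq].
- exact: cotangent_flow0.
- by split; [exact: (near_dom_flow iq)|exact: (derivable_cotangent_flow iq)].
- exact: (cotangent_crdK As).
- exact: (differentiable_cotangent_transition As).
Qed.

Lemma near_pairing_flow q (p : cotangent A q) (v : tangent A q) i : dom i q ->
  \forall e \near (0 : R),
    \sum_k (@crd _ _ (cotangent_atlas A) i
              (cotangent_flow Phi e (existT (cotangent A) q p))).2 0 k *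
           (@crd _ _ (tangent_atlas A) i
              (tangent_map (Phi e) (existT (tangent A) q v))).2 0 k =
    p v.
Proof.
move=> iq; apply: filterS2 (near_flow_time q) (near_dom_flow iq) => e [De De'] ie.
have qE := nbhs_singleton (near_flowK De De').
set p' := cotangent_flow _ _ _; pose w := differential A (Phi e) q v.
(* The sum is the pairing of the two lifted points at Phi_e(q), written in chart i. *)
transitivity (projT2 p' w).
  rewrite (cotangentE As (projT2 p') w ie).
  by apply: eq_bigr => k _; rewrite mxE.
rewrite (cotangent_flowE _ _ iq (esym qE)) (cotangentE As p v iq).
apply: eq_bigr => k _; congr (_ * _ 0 k).
rewrite (differential_comp As).
- by rewrite (differential_near_id As v i (near_flowK De De')).
- exact: (flow_continuous_space De).
- exact: (flow_chart_differentiable De).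
- exact: (flow_continuous_space De').
- exact: (flow_chart_differentiable De').
Qed.

Lemma lifts_pairing q (p : cotangent A q) (v : tangent A q) i : dom i q ->
  let z := existT (cotangent A) q p in let y := existT (tangent A) q v in
  \sum_k ((@crd _ _ (cotangent_atlas A) i z).2 0 k * (tangent_lift Phi y i).2 0 k +
          (@crd _ _ (tangent_atlas A) i y).2 0 k * (cotangent_lift Phi z i).2 0 k) = 0.
Proof.
move=> iq z y.
have [z0 /(_ i iq)[_ dz]] := cotangent_flow_velocity z.
have [y0 /(_ i iq)[_ dy]] := tangent_flow_velocity y.
have [_ dE] := is_derive_sum_mul dz dy; move: dE.
(* The sum is the derivative at 0 of the pairing along the lifted flows, which is constant near
   0. *)
rewrite /comp z0 y0 => <-; rewrite (near_eq_derive _ (near_pairing_flow p v iq)).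
exact: derive_cst.
Qed.

End Flow.

Theorem proposition2p3 (R : realType) (n : nat) (M : manifold R n)
  (f : vector_field (matlas M)) (f_smooth : smooth_field f)
  (D : set (R * M)) (Phi : R -> M -> M) (Phi_flow : local_flow f D Phi)
  (J : set R) (J_open : open J) (J_interval : is_interval J)
  (q : R -> M)
  (p : forall t, cotangent (matlas M) (q t))
  (dq : forall t, tangent (matlas M) (q t))
  (adjoint : integral_curve (cotangent_lift Phi) J
     (fun t => existT (cotangent (matlas M)) (q t) (p t)))
  (variational : integral_curve (tangent_lift Phi) J
     (fun t => existT (tangent (matlas M)) (q t) (dq t))) :
  forall t, J t -> is_derive t 1 (fun s => pairing (p s) (dq s)) 0.
Proof.
move=> t Jt; have As := manifold_smooth M; have [i iq] := atlas_cover As (q t).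
have [_ /(_ i iq)[iqs dp]] := adjoint t Jt.
have [_ /(_ i iq)[_ ddq]] := variational t Jt.
have := is_derive_sum_mul dp ddq.
rewrite (lifts_pairing Phi_flow (p t) (dq t) iq); apply: near_eq_is_derive.
(* For s near t the curve stays in chart i, where the pairing is the sum just differentiated. *)
apply: filterS iqs => s is_; rewrite /pairing (cotangentE As (p s) (dq s) is_).
by apply: eq_bigr => k _; rewrite mxE.
Qed.
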